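(* Let $X$ be a finite set. The order complex $$\triangle\bigl(\operatorname{Bip}(X)\setminus\{\emptyset,X\times X\}\bigr)$$ is not Cohen--Macaulay.
   Context: A relation $U\subseteq X\times X$ on a finite set $X$ is bipartitional if both $U$ and $(X\times X)\setminus U$ are transitive. $\operatorname{Bip}(X)$ is the set of bipartitional relations on $X$, partially ordered by inclusion; its minimum is $\emptyset$ and its maximum is $X\times X$. The order complex $\triangle(Q)$ of a partially ordered set $Q$ is the simplicial complex whose vertices are the elements of $Q$ and whose faces are the chains of $Q$. Cohen--Macaulay is meant in the usual sense: a finite simplicial complex is Cohen--Macaulay (over a given coefficient field, or over $\mathbb{Z}$) if for every face, including the empty face, the reduced homology of its link vanishes in all degrees below the dimension of the link.
   Formalization: The set X is assumed to have at least two elements: if X has at most one element, Bip(X) without ∅ and X×X is empty, so the order complex is {∅}, which is vacuously Cohen–Macaulay and the claim fails. *)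

(* Defs.v *)
From HB Require Import structures.
From mathcomp Require Import all_boot all_order all_algebra.

Set Implicit Arguments.
Unset Strict Implicit.
Unset Printing Implicit Defensive.

Import Order.TTheory GRing.Theory Num.Theory.

Local Open Scope ring_scope.

(* A relation on X is its graph, a subset of X * X. *)
Definition trans_rel (X : finType) (U : {set X * X}) : bool :=
  [forall x, forall y, forall z,
     [&& (x, y) \in U & (y, z) \in U] ==> ((x, z) \in U)].

Definition bipartitional (X : finType) (U : {set X * X}) : bool :=
  trans_rel U && trans_rel (~: U).

Definition Bip (X : finType) : {set {set X * X}} :=
  [set U : {set X * X} | bipartitional U].

(* A finite simplicial complex is given by the set of its faces (a nonempty
   family of sets, closed under taking subsets); the elements of the ambient
   type V that lie in no face are not vertices of the complex. *)
Definition simplicial_complex (V : finType) (D : {set {set V}}) : Prop :=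
  set0 \in D /\ forall F G : {set V}, F \in D -> G \subset F -> G \in D.

(* A has the order induced from P. *)
Definition order_complex (d : Order.disp_t) (P : finPOrderType d)
    (A : {set P}) : {set {set P}} :=
  [set C : {set P} | (C \subset A) &&
     [forall x in C, forall y in C, (x >=< y)%O]].

Lemma order_complexP (d : Order.disp_t) (P : finPOrderType d) (A : {set P}) :
  simplicial_complex (order_complex A).
Proof.
split=> [|F G].
  rewrite inE sub0set; apply/forall_inP => x; by rewrite inE.
rewrite !inE => /andP[FA /forall_inP cF] GF.
rewrite (subset_trans GF FA); apply/forall_inP => x xG.
apply/forall_inP => y yG.
by move/forall_inP: (cF x (subsetP GF x xG)); apply; apply: (subsetP GF).
Qed.

Definition link (V : finType) (D : {set {set V}}) (F : {set V}) :
    {set {set V}} :=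
  [set G : {set V} | [disjoint F & G] && (F :|: G \in D)].

(* A face with k elements has dimension k - 1; the complex {set0} has
   dimension -1. *)
Definition dim_complex (V : finType) (D : {set {set V}}) : int :=
  (\max_(F in D) #|F|)%N%:Z - 1.

Section ReducedHomology.

Variables (R : comNzRingType) (V : finType).

(* The coefficient function c stands for the chain \sum_F c F [F]; the empty
   face spans the chains of degree -1. *)
Definition is_chain (D : {set {set V}}) (i : int)
    (c : {ffun {set V} -> R}) : Prop :=
  forall F : {set V}, c F != 0 -> F \in D /\ #|F|%:Z = i + 1.

(* Faces are oriented by the enumeration of V. *)
Definition vertex_pos (F : {set V}) (v : V) : nat :=
  #|[set w in F | (enum_rank w < enum_rank v)%N]|.

(* The linear map [F] |-> \sum_(v in F) (-1)^(vertex_pos F v) [F :\ v]. *)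
Definition boundary (c : {ffun {set V} -> R}) : {ffun {set V} -> R} :=
  [ffun G : {set V} =>
     \sum_(F : {set V}) \sum_(v in F | F :\ v == G)
        (-1) ^+ vertex_pos F v * c F].

Definition reduced_cycle (D : {set {set V}}) (i : int)
    (c : {ffun {set V} -> R}) : Prop :=
  is_chain D i c /\ boundary c = 0.

Definition reduced_boundary (D : {set {set V}}) (i : int)
    (c : {ffun {set V} -> R}) : Prop :=
  exists2 b, is_chain D (i + 1) b & boundary b = c.

(* The quotient of the i-cycles by the i-boundaries is zero. *)
Definition reduced_homology_vanishes (D : {set {set V}}) (i : int) : Prop :=
  forall c, reduced_cycle D i c -> reduced_boundary D i c.

End ReducedHomology.

Definition cohen_macaulay (R : comNzRingType) (V : finType)
    (D : {set {set V}}) : Prop :=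
  forall F : {set V}, F \in D ->
  forall i : int, i < dim_complex (link D F) ->
  reduced_homology_vanishes R (link D F) i.

(* Main.v *)
(** Fix a pair P = {a, b} of points of X, and let U = P * (X \ P) and
    V = P * X.  A bipartitional relation strictly between U and V contains
    exactly one of (a, b) and (b, a), and comparable relations contain the same
    one, so the open interval (U, V) is disconnected.  Its order
    complex contains an edge, and is the link of any chain maximal among those
    whose elements all lie below U or above V; so the reduced homology of that
    link is nonzero in degree 0, below its dimension. *)

Require Import Defs.
From mathcomp Require Import all_boot all_order all_algebra.
(* Orders every type {set T} by inclusion. *)
Import Order.DefaultSetSubsetOrder.

Set Implicit Arguments.
Unset Strict Implicit.
Unset Printing Implicit Defensive.

Import Order.TTheory GRing.Theory Num.Theory.

Local Open Scope ring_scope.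

(** * Degree-zero reduced homology of disconnected complexes *)

Section Disconnected.

Variables (R : comNzRingType) (V : finType).

Definition point_diff (u v : V) : {ffun {set V} -> R} :=
  [ffun F => (F == [set u])%:R - (F == [set v])%:R].

Lemma boundary_point_diff (u v : V) : boundary (point_diff u v) = 0.
Proof.
have pickF (f : {set V} -> R) w : \sum_F f F * (F == [set w])%:R = f [set w].
  rewrite (bigD1 [set w]) //= eqxx mulr1 big1 ?addr0 // => F /negPf ->.
  by rewrite mulr0.
have pos1 G w : \sum_(x in [set w] | [set w] :\ x == G)
    (-1) ^+ vertex_pos [set w] x = (set0 == G)%:R :> R.
  rewrite big_mkcondr big_set1 setDv; case: eqP => // _.
  rewrite /vertex_pos (_ : [set _ in _ | _] = set0) ?cards0 ?expr0 //.
  apply/setP => x; rewrite !inE; case: eqP => // ->.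
  by rewrite ltnn.
apply/ffunP => G; rewrite !ffunE.
under eq_bigr => F _.
  rewrite -mulr_suml ffunE mulrBr; over.
by rewrite sumrB !pickF !pos1 subrr.
Qed.

(** The inner sum is the coefficient of the vertex [w] in the boundary of the edge [F]. The two ends
    of [F] get opposite signs, which cancel if both lie in [S]; if neither does, every term is
    zero. *)
Lemma edge_sign_sum (F S : {set V}) :
    #|F| = 2%N -> (F \subset S) || [disjoint F & S] ->
  \sum_(w in S) \sum_(x in F | F :\ x == [set w])
    (-1) ^+ vertex_pos F x = 0 :> R.
Proof.
move=> F2 /orP[FS|FS]; last first.
  rewrite big1 // => w wS; rewrite big_pred0 // => x.
  apply/negP => /andP[_ /eqP Fx].
  have: w \in F :\ x by rewrite Fx set11.
  by rewrite inE (disjointFl FS wS) andbF.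
(* Naming the ends in enumeration order gives them positions 0 and 1, hence signs 1 and -1. *)
have [x [y [ltxy defF]]] : exists x y,
    (enum_rank x < enum_rank y)%N /\ F = [set x; y].
  have /cards2P[x [y [nxy ->]]] : #|F| == 2%N by apply/eqP.
  have [lt|lt|/val_inj/enum_rank_inj xy] := ltngtP (enum_rank x) (enum_rank y).
  - by exists x, y.
  - by exists y, x; rewrite setUC.
  - by rewrite xy eqxx in nxy.
have nxy : x != y by apply: contraTneq ltxy => ->; rewrite ltnn.
have Dx : F :\ x = [set y].
  apply/setP => z; rewrite defF !inE; case: (eqVneq z x) => //= ->.
  by rewrite (negPf nxy).
have Dy : F :\ y = [set x].
  apply/setP => z; rewrite defF !inE; case: (eqVneq z y) => //= [->|_].
    by rewrite eq_sym (negPf nxy).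
  by rewrite orbF.
have posx : vertex_pos F x = 0%N.
  apply/eqP; rewrite cards_eq0 -subset0; apply/subsetP => z.
  rewrite defF !inE => /andP[/orP[]/eqP ->]; first by rewrite ltnn.
  by rewrite ltnNge ltnW.
have posy : vertex_pos F y = 1%N.
  rewrite /vertex_pos (_ : [set _ in _ | _] = [set x]) ?cards1 //.
  apply/setP => z; rewrite defF !inE.
  case: (eqVneq z x) => /= [->|_]; first by rewrite ltxy.
  by case: eqP => // ->; rewrite ltnn.
have sumS z s : z \in S ->
    \sum_(w in S | [set z] == [set w]) (-1) ^+ s = (-1) ^+ s :> R.
  move=> zS; rewrite (big_pred1 z) // => w /=.
  rewrite (inj_eq set1_inj) (eq_sym z); case: eqP => [->|]; last by rewrite andbF.
  by rewrite zS.
rewrite (exchange_big_dep (mem F)) /=; last by move=> w x' _ /andP[].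
have [xS yS] : x \in S /\ y \in S.
  by split; apply: (subsetP FS); rewrite defF !inE eqxx ?orbT.
under eq_bigr => z zF.
  rewrite (eq_bigl (fun w => (w \in S) && (F :\ z == [set w]))); last first.
    by move=> w; rewrite zF.
  over.
rewrite (bigD1 x) /=; last by rewrite defF !inE eqxx.
rewrite [X in _ + X](big_pred1 y); last first.
  move=> z; rewrite defF !inE /=; case: (eqVneq z x) => /= [->|_].
    by rewrite (negPf nxy).
  by rewrite andbT.
by rewrite Dx Dy posx posy !sumS // expr0 expr1 subrr.
Qed.

(** No edge joins a vertex in [S] to one outside, so [u] and [v] lie in different components, and
    their difference is a cycle that bounds nothing. *)
Lemma disconnected_homology (D : {set {set V}}) (S : {set V}) (u v : V) :
    (forall F, F \in D -> #|F| = 2%N -> (F \subset S) || [disjoint F & S]) ->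
    [set u] \in D -> [set v] \in D -> u \in S -> v \notin S ->
  ~ reduced_homology_vanishes R D 0.
Proof.
move=> sepS uD vD uS vS /(_ (point_diff u v)) [].
  split; last exact: boundary_point_diff.
  move=> F; rewrite ffunE.
  case: (F =P [set u]) => [->|_]; first by rewrite cards1.
  by case: (F =P [set v]) => [->|_]; [rewrite cards1 | rewrite subrr eqxx].
move=> b bchain db.
(* The functional c |-> \sum_(w in S) c {w} kills boundaries, not [u] - [v]. *)
have: \sum_(w in S) boundary b [set w] = 1.
  rewrite db (bigD1 u) //= ffunE eqxx (inj_eq set1_inj) big1 => [|w].
    by case: eqP vS => [<-|_ _]; [rewrite uS | rewrite subr0 addr0].
  case/andP=> wS nwu; rewrite ffunE !(inj_eq set1_inj) (negPf nwu).
  by case: eqP vS => [<-|]; [rewrite wS | rewrite subrr].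
under eq_bigr do rewrite ffunE.
rewrite exchange_big big1 => [/esym/eqP|F _]; first by rewrite oner_eq0.
under eq_bigr do rewrite -mulr_suml.
rewrite -mulr_suml; have [->|/bchain[FD [F2]]] := eqVneq (b F) 0.
  by rewrite mulr0.
by rewrite edge_sign_sum ?mul0r //; apply: sepS.
Qed.

End Disconnected.

(** * Open intervals as links in an order complex *)

(** The ends [l] and [u] may be missing from [A], provided that they then bound [A]. This covers the
    case where [X] has two points and the ends are the deleted minimum and maximum. *)
Lemma link_open_interval (d : Order.disp_t) (P : finPOrderType d)
    (A : {set P}) (l u : P) :
    (l < u)%O ->
    (forall x, x \in A -> l \notin A -> (l <= x)%O) ->
    (forall x, x \in A -> u \notin A -> (x <= u)%O) ->
  exists2 F, F \in order_complex A &
    link (order_complex A) F =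
      order_complex [set x in A | (l < x)%O && (x < u)%O].
Proof.
move=> ltlu lmin umax.
pose Q (F : {set P}) := (F \in order_complex A) &&
  [forall x in F, (x <= l)%O || (u <= x)%O].
have Q0 : Q set0.
  rewrite /Q (order_complexP A).1; apply/forall_inP => x; by rewrite inE.
have ocP (B C : {set P}) : reflect (C \subset B /\ {in C &, forall x y, (x >=< y)%O})
    (C \in order_complex B).
  rewrite inE; apply: (iffP andP) => -[CB cC]; split=> //.
    by move=> x y xC yC; move/forall_inP: cC => /(_ x xC)/forall_inP/(_ y yC).
  by apply/forall_inP => x xC; apply/forall_inP => y yC; apply: cC.
have ocU1 x C : x \in A -> C \in order_complex A ->
    {in C, forall y, (x >=< y)%O} -> x |: C \in order_complex A.
  move=> xA /ocP[CA cC] xC; apply/ocP; split; first by rewrite subUset sub1set xA.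
  move=> y z /setU1P[->|yC] /setU1P[->|zC].
  - exact: comparablexx.
  - exact: xC.
  - by rewrite comparable_sym xC.
  - exact: cC.
(* Largest cardinality gives maximality: an admissible element comparable with all of [F] already
   lies in [F], since adding it would enlarge [F]. *)
case: (@arg_maxnP _ set0 Q (fun F : {set P} => #|F|) Q0) => F /andP[FA /forall_inP QF]
  Fmax.
have max_in x : x \in A -> {in F, forall y, (x >=< y)%O} ->
    (x <= l)%O || (u <= x)%O -> x \in F.
  move=> xA xF xlu; apply: contraT => xnF.
  have/Fmax : Q (x |: F).
    rewrite /Q ocU1 //; apply/forall_inP => y /setU1P[->//|]; exact: QF.
  by rewrite cardsU1 xnF add1n /= ltnn.
(* Hence [l] and [u] belong to [F] as soon as they belong to [A]. *)
have compl y : y \in F -> (l >=< y)%O /\ (u >=< y)%O.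
  move=> /QF/orP[yl|uy]; split.
  - exact: ge_comparable.
  - exact/ge_comparable/(le_trans yl)/ltW.
  - exact/le_comparable/(le_trans (ltW ltlu)).
  - exact: le_comparable.
have lF : l \in A -> l \in F by move=> lA; rewrite max_in ?lexx // => y /compl[].
have uF : u \in A -> u \in F by move=> uA; rewrite max_in ?lexx ?orbT // => y /compl[].
exists F => //; apply/setP => G; rewrite inE.
apply/andP/ocP => [[FG /ocP[/subsetP FGA cFG]]|[/subsetP GI cG]]; split.
- apply/subsetP => x xG.
  have xA : x \in A by apply: FGA; rewrite inE xG orbT.
  have xF : {in F, forall y, (x >=< y)%O}.
    by move=> y yF; apply: cFG; rewrite inE ?xG ?yF ?orbT.
  (* By maximality such an [x] would lie in [F], which [G] avoids. It then remains to compare [x]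
     with [l] and with [u]. *)
  have : ~~ ((x <= l)%O || (u <= x)%O).
    by apply/negP => /(max_in x xA xF) /(disjointFr FG); rewrite xG.
  rewrite negb_or inE xA => /andP[nxl nux] /=; apply/andP; split.
    have /orP[xl|lx] : (x >=< l)%O.
    - have [/lF /xF //|lA] := boolP (l \in A).
      exact/ge_comparable/lmin.
    - by rewrite xl in nxl.
    by rewrite lt_neqAle lx andbT; apply: contraNneq nxl => ->.
  have /orP[xu|ux] : (x >=< u)%O.
  - have [/uF /xF //|uA] := boolP (u \in A).
    exact/le_comparable/umax.
  - by rewrite lt_neqAle xu andbT; apply: contraNneq nux => ->.
  by rewrite ux in nux.
- by move=> x y xG yG; apply: cFG; rewrite inE ?xG ?yG orbT.
- apply/pred0P => x /=; apply/negP => /andP[/QF xlu /GI].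
  by rewrite inE => /and3P[_ lx xu]; move: xlu; rewrite (lt_geF lx) (lt_geF xu).
(* The comparison passes through [l] or [u]. *)
- have cFG x y : x \in F -> y \in G -> (x >=< y)%O.
    move=> /QF xlu /GI; rewrite inE => /and3P[_ /ltW ly /ltW yu].
    case/orP: xlu => [xl|ux]; first exact/le_comparable/(le_trans xl).
    exact/ge_comparable/(le_trans yu).
  have [FsA cF] := ocP _ _ FA.
  apply/ocP; split.
    by rewrite subUset FsA; apply/subsetP => x /GI; rewrite inE => /andP[].
  move=> x y; rewrite !inE => /orP[xF|xG] /orP[yF|yG].
  + exact: cF.
  + exact: cFG.
  + by rewrite comparable_sym cFG.
  + exact: cG.
Qed.

(** * Bipartitional relations in the interval attached to a pair of points *)

Section PairInterval.

Variables (X : finType) (a b : X).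
Hypothesis nab : a != b.

Let P := [set a; b].

Definition pair_bottom : {set X * X} := [set p | (p.1 \in P) && (p.2 \notin P)].
Definition pair_top : {set X * X} := [set p | p.1 \in P].

Lemma trans_relP (U : {set X * X}) :
  reflect (forall x y z, (x, y) \in U -> (y, z) \in U -> (x, z) \in U)
          (trans_rel U).
Proof.
apply: (iffP forallP) => [tU x y z xy yz | tU x].
  by move/forallP/(_ y)/forallP/(_ z): (tU x); rewrite xy yz.
apply/forallP => y; apply/forallP => z; apply/implyP => /andP[]; exact: tU.
Qed.

(** Strictness at each end gives a pair in [P * P] that lies in [W] and one that does not. If [W]
    contained both arcs, transitivity would put all of [P * P] in [W]; if neither, transitivity of
    the complement would put all of it outside. *)
Lemma pair_interval_arc (W : {set X * X}) :
    bipartitional W -> pair_bottom \proper W -> W \proper pair_top ->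
  ((a, b) \in W) = ((b, a) \notin W).
Proof.
case/andP=> /trans_relP tW /trans_relP tCW /properP[UW [p pW pU]].
case/properP=> /subsetP WV [q qV qW].
case: p q pW pU qV qW => [p1 p2] [q1 q2] pW pU qV qW.
have := WV _ pW; rewrite !inE /= => p1P.
move: pU qV; rewrite !inE /= -[X in ~~ (X && _)]/(_ || _) p1P /= negbK => p2P q1P.
have q2P : (q2 == a) || (q2 == b).
  apply: contraR qW => q2P; apply: (subsetP UW); rewrite !inE /= q1P.
  exact: q2P.
have [abW|abW] := boolP ((a, b) \in W); have [baW|baW] := boolP ((b, a) \in W) => //.
- case/negP: qW.
  by case/orP: q1P => /eqP ->; case/orP: q2P => /eqP ->;
    rewrite ?abW ?baW // ?(tW _ _ _ abW baW) ?(tW _ _ _ baW abW).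
- have abC : (a, b) \in ~: W by rewrite inE.
  have baC : (b, a) \in ~: W by rewrite inE.
  suff: (p1, p2) \in ~: W by rewrite inE pW.
  by case/orP: p1P => /eqP ->; case/orP: p2P => /eqP ->;
    rewrite ?abC ?baC // ?(tCW _ _ _ abC baC) ?(tCW _ _ _ baC abC).
Qed.

(** This is the relation of the ordered blocks [a], [b], rest. With the loop added at [a], it yields
    an edge in the interval; exchanging [a] and [b] yields a vertex of another component. *)
Definition pair_arc : {set X * X} := (a, b) |: pair_bottom.
Definition pair_arc_loop : {set X * X} := (a, a) |: pair_arc.

Lemma pair_bottom_bip : bipartitional pair_bottom.
Proof.
apply/andP; split; apply/trans_relP => x y z; rewrite !inE /=;
  by case: (_ || _); case: (_ || _); case: (_ || _).
Qed.

Lemma pair_top_bip : bipartitional pair_top.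
Proof. by apply/andP; split; apply/trans_relP => x y z; rewrite !inE. Qed.

Lemma pair_arc_bip : bipartitional pair_arc /\ bipartitional pair_arc_loop.
Proof.
have nba : b != a by rewrite eq_sym.
split; apply/andP; split; apply/trans_relP => x y z; rewrite !inE /= !xpair_eqE;
  (* Membership depends only on whether each coordinate is [a], [b] or another point, so finitely
     many cases remain. *)
  (have [->|_] := eqVneq x a; last have [_|_] := eqVneq x b);
  (have [->|_] := eqVneq y a; last have [_|_] := eqVneq y b);
  (have [->|_] := eqVneq z a; last have [_|_] := eqVneq z b);
  by rewrite ?eqxx ?(negPf nab) ?(negPf nba).
Qed.

Lemma pair_arc_proper :
  [/\ pair_bottom \proper pair_arc, pair_arc \proper pair_arc_loop
    & pair_arc_loop \proper pair_top].
Proof.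
have nba : b != a by rewrite eq_sym.
split.
- by apply: properUr; rewrite sub1set !inE !eqxx orbT andbF.
- by apply: properUr; rewrite sub1set !inE !xpair_eqE !eqxx /= (negPf nab).
- apply/properP; split.
    apply/subsetP => -[x y]; rewrite !inE /= !xpair_eqE.
    by case/or3P=> /andP[-> //] _; rewrite ?orbT.
  by exists (b, b); rewrite !inE ?xpair_eqE /= eqxx orbT ?(negPf nba).
Qed.

Lemma pair_bottom_proper_top : pair_bottom \proper pair_top.
Proof.
case: pair_arc_proper => ba aal lt.
exact: proper_trans ba (proper_trans aal lt).
Qed.

End PairInterval.

(** * The link that violates the Cohen-Macaulay condition *)

Lemma lt_proper (T : finType) (A B : {set T}) : (A < B)%O = (A \proper B).
Proof. by rewrite lt_neqAle Order.SetSubsetOrder.leEsubset properEneq. Qed.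

Lemma Bip_not_cohen_macaulay (R : comNzRingType) (X : finType) :
    (1 < #|X|)%N ->
  ~ cohen_macaulay R (order_complex (Bip X :\: [set set0; setT])).
Proof.
case/card_gt1P=> a [b [_ _ nab]] cm.
pose A := Bip X :\: [set set0; setT].
pose I := [set W in A | (pair_bottom a b < W)%O && (W < pair_top a b)%O].
have inA W : bipartitional W -> W != set0 -> W != setT -> W \in A.
  by move=> bW W0 WT; rewrite !inE negb_or W0 WT.
have inI W : bipartitional W -> pair_bottom a b \proper W ->
    W \proper pair_top a b -> W \in I.
  move=> bW UW WV; rewrite inE !lt_proper UW WV !andbT; apply: inA => //.
    by apply: contraTneq UW => ->; rewrite properE sub0set andbF.
  by apply: contraTneq WV => ->; rewrite properE subsetT andbF.
(* The bottom omits [(a, a)], so it can be missing from [A] only by being empty. Dually, the top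
   contains [(a, a)] and can be missing only by being full. *)
have bot_sub W : W \in A -> pair_bottom a b \notin A -> (pair_bottom a b <= W)%O.
  move=> _; rewrite Order.SetSubsetOrder.leEsubset; apply: contraNT => nUW; apply: inA.
  - exact: pair_bottom_bip.
  - by apply: contraNneq nUW => ->; rewrite sub0set.
  - by apply/eqP => /setP/(_ (a, a)); rewrite !inE eqxx.
have top_sup W : W \in A -> pair_top a b \notin A -> (W <= pair_top a b)%O.
  move=> _; rewrite Order.SetSubsetOrder.leEsubset; apply: contraNT => nWV; apply: inA.
  - exact: pair_top_bip.
  - by apply/eqP => /setP/(_ (a, a)); rewrite !inE eqxx.
  - by apply: contraNneq nWV => ->; rewrite subsetT.
have [] := @link_open_interval _ _ A (pair_bottom a b) (pair_top a b) _ bot_sub top_sup.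
  by rewrite lt_proper pair_bottom_proper_top.
rewrite -/I => F FA linkF.
have nba : b != a by rewrite eq_sym.
(* The ends are symmetric in [a] and [b], so the facts about [pair_arc] also serve for the reversed
   arc. *)
have bottomC : pair_bottom b a = pair_bottom a b by rewrite /pair_bottom setUC.
have topC : pair_top b a = pair_top a b by rewrite /pair_top setUC.
have [bipab bipabl] := pair_arc_bip nab.
have [bipba _] := pair_arc_bip nba.
have [ltab ltabl ltabt] := pair_arc_proper nab.
have [] := pair_arc_proper nba; rewrite bottomC topC => ltba ltbal ltbat.
have abI : pair_arc a b \in I by apply: inI => //; apply: proper_trans ltabt.
have ablI : pair_arc_loop a b \in I by apply: inI => //; apply: proper_trans ltabl.
have baI : pair_arc b a \in I by apply: inI => //; apply: proper_trans ltbat.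
have vertI W : W \in I -> [set W] \in order_complex I.
  move=> WI; rewrite inE sub1set WI; apply/forall_inP => x /set1P ->.
  by apply/forall_inP => y /set1P ->; apply: comparablexx.
(* An edge is needed here: only in dimension at least 1 does the Cohen-Macaulay condition reach
   degree 0. *)
have dimI : 0 < dim_complex (order_complex I).
  have edge : [set pair_arc a b; pair_arc_loop a b] \in order_complex I.
    rewrite inE subUset !sub1set abI ablI.
    have lt : (pair_arc a b < pair_arc_loop a b)%O by rewrite lt_proper.
    apply/forall_inP => x /set2P[] ->; apply/forall_inP => y /set2P[] ->;
      by rewrite ?comparablexx // ?(lt_comparable lt) ?(gt_comparable lt).
  rewrite /dim_complex subr_gt0 ltz_nat.
  apply: leq_trans (leq_bigmax_cond _ edge).
  by rewrite cards2 proper_neq.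
have := cm F FA 0; rewrite linkF => /(_ dimI).
apply: (@disconnected_homology R _ (order_complex I)
  [set W : {set X * X} | (a, b) \in W] (pair_arc a b) (pair_arc b a)).
2,3: exact: vertI.
2: by rewrite !inE eqxx.
2: by rewrite !inE xpair_eqE (negPf nab) !eqxx orbT.
move=> G; rewrite inE => /andP[/subsetP GI /forall_inP cG] _.
have [_|] := boolP [disjoint G & _]; first by rewrite orbT.
rewrite orbF => /pred0Pn[W /= /andP[WG]].
rewrite inE => abW; apply/subsetP => W' W'G; rewrite inE.
have arc T : T \in G -> ((a, b) \in T) = ((b, a) \notin T).
  move/GI; rewrite !inE !lt_proper => /and3P[/andP[_ bT] UT TV].
  exact: (pair_interval_arc bT UT TV).
have /forall_inP/(_ W' W'G) := cG W WG.
rewrite /Order.comparable !Order.SetSubsetOrder.leEsubset.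
(* A larger relation keeps [(a, b)]. A smaller one still omits [(b, a)], so by [arc] it contains
   [(a, b)]. *)
case/orP=> /subsetP sub; first exact: sub abW.
rewrite arc //; apply: contraTN abW => /sub baW.
by rewrite arc // baW.
Qed.

(* For #|X| <= 1 the complex is {set0}, which is Cohen-Macaulay. *)
Theorem corollary9p4 (X : finType) (hX : (1 < #|X|)%N) :
  (forall K : fieldType,
     ~ cohen_macaulay K (order_complex (Bip X :\: [set set0; setT])))
  /\ ~ cohen_macaulay int (order_complex (Bip X :\: [set set0; setT])).
Proof. by split=> [K|]; apply: Bip_not_cohen_macaulay. Qed.
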